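(* Let $X$ be an infinite-dimensional separable Banach space of analytic functions on $\mathbb{D}$ such that: (1) $H^\infty$ is dense in $X$ (in particular $H^\infty\subset X$); and (2) for every analytic self-map $\psi:\mathbb{D}\to\mathbb{D}$ and every $u\in H^\infty$, the weighted composition operator $C_{u,\psi}$ is a bounded operator on $X$ and $\|(C_{u,\psi})^n f\|_X\le \|u^{(n)}\|_X\,\|f\|_\infty$ for all $f\in H^\infty$ and all $n\in\mathbb{N}$. Let $\varphi:\mathbb{D}\to\mathbb{D}$ be an analytic self-map and $w\in H^\infty$. If $$\liminf_{N\to\infty}\frac1N\sum_{j=1}^N\|w^{(j)}\|_X=0,$$ then the following assertions are equivalent: (i) $C_{w,\varphi}$ is densely mean Li--Yorke chaotic on $X$; (ii) $C_{w,\varphi}$ has a residual set of absolutely mean irregular vectors in $X$; (iii) $C_{w,\varphi}$ is not absolutely Ces\`aro bounded on $X$; (iv) $\limsup_{N\to\infty}\frac1N\sum_{j=1}^N\|(C_{w,\varphi})^jy_0\|_X>0$ for some $y_0\in X$.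
   Context: $\mathbb{D}$ is the open unit disk in $\mathbb{C}$, $\mathbb{N}=\{1,2,\dots\}$. $H^\infty$ is the space of bounded analytic functions on $\mathbb{D}$ with $\|f\|_\infty=\sup_{z\in\mathbb{D}}|f(z)|$. For an analytic self-map $\varphi$ of $\mathbb{D}$ and $w\in H^\infty$, the weighted composition operator is $C_{w,\varphi}f=w\cdot(f\circ\varphi)$; $\varphi^n$ denotes the $n$-fold iterate of $\varphi$; and $w^{(1)}=w$, $w^{(n)}=(w\circ\varphi^{n-1})\cdots(w\circ\varphi)\cdot w$ for $n\ge2$ (so $w^{(n)}$ depends on $\varphi$ too; $u^{(n)}$ is formed with $\psi$ in the same way), so that $(C_{w,\varphi})^nf=w^{(n)}\cdot(f\circ\varphi^n)$. Let $T$ be a bounded operator on a Banach space $X$. $T$ is mean Li--Yorke chaotic if there is an uncountable set $S\subset X$ such that for all distinct $x,y\in S$, $\liminf_{N\to\infty}\frac1N\sum_{j=1}^N\|T^jx-T^jy\|=0$ and $\limsup_{N\to\infty}\frac1N\sum_{j=1}^N\|T^jx-T^jy\|>0$; it is densely mean Li--Yorke chaotic if $S$ can be chosen dense in $X$. A vector $x$ is absolutely mean irregular for $T$ if $\liminf_{N\to\infty}\frac1N\sum_{j=1}^N\|T^jx\|=0$ and $\limsup_{N\to\infty}\frac1N\sum_{j=1}^N\|T^jx\|=\infty$. $T$ is absolutely Ces\`aro bounded if there is $C>0$ with $\sup_{N\in\mathbb{N}}\frac1N\sum_{j=1}^N\|T^jx\|\le C\|x\|$ for all $x\in X$. A subset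 of $X$ is residual if its complement is of first category (meager). *)

(* Defs.v *)
From HB Require Import structures.
From mathcomp Require Import all_boot all_order all_algebra.
From mathcomp Require Import all_classical all_reals all_analysis.
From mathcomp Require Import complex.
Import numFieldNormedType.Exports.
Set Implicit Arguments.
Unset Strict Implicit.
Unset Printing Implicit Defensive.
Import Order.TTheory GRing.Theory Num.Theory.
Local Open Scope classical_set_scope.
Local Open Scope ring_scope.

(* Norms of normed R[i]-modules take their values in R[i]; they are real and
   nonnegative there, so nothing is lost by taking the real part. *)
Definition rnorm (R : realType) (V : normedModType R[i]) (x : V) : R :=
  complex.Re `|x|.

Definition cabs (R : realType) (z : R[i]) : R := complex.Re `|z|.

Definition cesaro_mean (R : realType) (u : nat -> R) : (\bar R)^nat :=
  fun N => (N%:R^-1 * \sum_(1 <= j < N.+1) u j)%:E.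

Section Topology.
Variables (R : realType) (X : normedModType R[i]).

Definition separable : Prop := exists2 A : set X, countable A & dense A.

Definition infinite_dimensional : Prop :=
  ~ exists (n : nat) (v : 'I_n -> X),
      forall x : X, exists c : 'I_n -> R[i], x = \sum_(i < n) c i *: v i.

Definition nowhere_dense (A : set X) : Prop := interior (closure A) = set0.

Definition meager (A : set X) : Prop :=
  exists F : nat -> set X,
    (forall n, nowhere_dense (F n)) /\ A `<=` \bigcup_n F n.

Definition residual (A : set X) : Prop := meager (~` A).

End Topology.

Section Dynamics.
Variables (R : realType) (X : normedModType R[i]).
Implicit Type T : X -> X.

Definition bounded_operator T : Prop :=
  linear T /\ exists M : R, forall x, rnorm (T x) <= M * rnorm x.

Definition mean_orbit T (x : X) : (\bar R)^nat :=
  cesaro_mean (fun j => rnorm (iter j T x)).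

Definition mean_orbit_dist T (x y : X) : (\bar R)^nat :=
  cesaro_mean (fun j => rnorm (iter j T x - iter j T y)).

Definition mean_Li_Yorke_set T (S : set X) : Prop :=
  forall x y, S x -> S y -> x <> y ->
    limn_einf (mean_orbit_dist T x y) = 0%E /\
    (0 < limn_esup (mean_orbit_dist T x y))%E.

Definition densely_mean_Li_Yorke_chaotic T : Prop :=
  exists S : set X, [/\ ~ countable S, dense S & mean_Li_Yorke_set T S].

Definition absolutely_mean_irregular T (x : X) : Prop :=
  limn_einf (mean_orbit T x) = 0%E /\ limn_esup (mean_orbit T x) = +oo%E.

Definition absolutely_Cesaro_bounded T : Prop :=
  exists2 C : R, 0 < C & forall (x : X) (N : nat), (0 < N)%N ->
    (mean_orbit T x N <= (C * rnorm x)%:E)%E.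

End Dynamics.

(* Functions on the disk are represented by total functions R[i] -> R[i];
   only their values on the disk are ever used. *)
Section Disk.
Variable R : realType.
Implicit Types (f h u w phi psi : R[i] -> R[i]).

Definition disk : set R[i] := [set z | cabs z < 1].

(* R[i]^o is R[i] as a normed module over itself, so [derivable] is complex
   differentiability; the disk being open, values outside play no role. *)
Definition analytic f : Prop :=
  forall z, disk z -> derivable (f : R[i]^o -> R[i]^o) z 1.

Definition self_map phi : Prop :=
  analytic phi /\ forall z, disk z -> disk (phi z).

Definition Hinf f : Prop :=
  analytic f /\ exists M : R, forall z, disk z -> cabs (f z) <= M.

Definition supnorm f : R := sup [set cabs (f z) | z in disk].

Definition wcomp u psi f : R[i] -> R[i] := fun z => u z * f (psi z).

Definition wprod u psi (n : nat) : R[i] -> R[i] :=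
  fun z => \prod_(k < n) u (iter k psi z).

End Disk.

(* A vector space X of functions on the disk is given by its evaluation map
   ev : X -> (R[i] -> R[i]); ev x is the function that x is. *)
Section FunctionSpace.
Variables (R : realType) (X : normedModType R[i]) (ev : X -> R[i] -> R[i]).

Definition represents (x : X) (h : R[i] -> R[i]) : Prop :=
  forall z, disk z -> ev x z = h z.

Record analytic_function_space : Prop := AnalyticFunctionSpace {
  ev_linear : forall (a : R[i]) (x y : X) (z : R[i]), disk z ->
    ev (a *: x + y) z = a * ev x z + ev y z;
  ev_analytic : forall x : X, analytic (ev x);
  ev_inj : forall x y : X, represents x (ev y) -> x = y }.

Definition in_space (h : R[i] -> R[i]) : Prop := exists x : X, represents x h.

(* The function h seen as a vector of X; the junk value 0 is only taken when
   h is not in X. *)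
Definition elt (h : R[i] -> R[i]) : X := xget 0 [set x | represents x h].

(* C_{u,psi} as an operator on X, meaningful when it maps X into X, which
   wcomp_bounded includes. *)
Definition wcomp_op (u psi : R[i] -> R[i]) : X -> X :=
  fun x => elt (wcomp u psi (ev x)).

Definition wcomp_bounded (u psi : R[i] -> R[i]) : Prop :=
  (forall x : X, in_space (wcomp u psi (ev x))) /\
  bounded_operator (wcomp_op u psi).

End FunctionSpace.

(* Main.v *)
(* The Cesaro mean of an orbit is dominated, on the dense subspace of bounded
   functions, by a multiple of that of [w^(j)], hence is small there along one
   common sequence of times.  If T is absolutely Cesaro bounded, an orbit whose
   means have lower limit 0 has means tending to 0 (one small iterate controls all
   later ones), and by density this extends to every vector.  Otherwise the
   vectors with unbounded means and means that are small together with those of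
   [w^(j)] form a residual set.  For such a vector y, the vectors whose means are
   dominated by those of y and [w^(j)] form a dense subspace V; by separability V
   contains a dense uncountable set of vectors pairwise distinct modulo the
   subspace of vectors with null means. *)
Require Import Defs.
From HB Require Import structures.
From mathcomp Require Import all_boot all_order all_algebra.
From mathcomp Require Import all_classical all_reals all_analysis.
From mathcomp Require Import complex.
Import numFieldNormedType.Exports.
Import Order.TTheory GRing.Theory Num.Theory.
Local Open Scope classical_set_scope.
Local Open Scope ring_scope.

Set Implicit Arguments.
Unset Strict Implicit.
Unset Printing Implicit Defensive.

(** * Real-valued norms, their topology, and the Baire category theorem *)

Section RealNorm.
Variables (R : realType) (V : normedModType R[i]).
Implicit Types (x y : V) (A : set V).

Lemma rnormE x : `|x| = (rnorm x)%:C%C.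
Proof. by rewrite /rnorm RRe_real. Qed.

Lemma rnorm_ge0 x : 0 <= rnorm x.
Proof. by have := normr_ge0 x; rewrite rnormE lecR. Qed.

Lemma rnorm0 : rnorm (0 : V) = 0.
Proof. by rewrite /rnorm normr0. Qed.

Lemma rnormD x y : rnorm (x + y) <= rnorm x + rnorm y.
Proof. by have := ler_normD x y; rewrite !rnormE -rmorphD lecR. Qed.

Lemma rnormZ (t : R) x : rnorm (t%:C%C *: x) = `|t| * rnorm x.
Proof.
rewrite {1}/rnorm normrZ rnormE normc_def /= expr0n addr0 sqrtr_sqr.
by rewrite /= mulr0 subr0.
Qed.

Lemma rnormN x : rnorm (- x) = rnorm x.
Proof. by rewrite /rnorm normrN. Qed.

Lemma rnorm_distC x y : rnorm (x - y) = rnorm (y - x).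
Proof. by rewrite -rnormN opprB. Qed.

Lemma rnorm_triangle x y z : rnorm (x - z) <= rnorm (x - y) + rnorm (y - z).
Proof. by apply: le_trans (rnormD _ _); rewrite addrA subrK. Qed.

Lemma ball_rnorm x (r : R) y : ball x r%:C%C y <-> rnorm (x - y) < r.
Proof. by rewrite -ball_normE /= rnormE ltcR. Qed.

(** Comparable numbers of [R[i]] share their imaginary part, so a positive radius is real.
    Neighbourhoods can then be described with radii in [R]. *)
Lemma gt0_real_complex (e : R[i]) : 0 < e -> e = (complex.Re e)%:C%C /\ 0 < complex.Re e.
Proof.
move=> e0; have ee : e = (complex.Re e)%:C%C by rewrite RRe_real ?gtr0_real.
by split => //; rewrite ee ltcR in e0.
Qed.

Lemma nbhs_rnormP x A :
  nbhs x A <-> exists2 r : R, 0 < r & forall y, rnorm (x - y) < r -> A y.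
Proof.
split => [/nbhs_ballP[e /= /gt0_real_complex[-> e0] eA]|[r r0 rA]].
  by exists (complex.Re e) => // y /ball_rnorm/eA.
by apply/nbhs_ballP; exists r%:C%C => /=; [rewrite ltcR|move=> y /ball_rnorm/rA].
Qed.

Lemma open_rnormP A : open A <->
  forall x, A x -> exists2 r : R, 0 < r & forall y, rnorm (x - y) < r -> A y.
Proof.
by rewrite openE; split => oA x /oA/nbhs_rnormP.
Qed.

Lemma dense_rnormP A : dense A <->
  forall x (r : R), 0 < r -> exists2 y, A y & rnorm (x - y) < r.
Proof.
split => [dA x r r0|dA O [x Ox] /open_rnormP/(_ _ Ox)[r r0 rO]].
  have [|y [/ball_rnorm xy Ay]] := dA _ _ (ball_open x r%:C%C).
    by exists x; apply/ball_rnorm; rewrite subrr rnorm0.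
  by exists y.
by have [y Ay /rO Oy] := dA x r r0; exists y.
Qed.

End RealNorm.

(* The library's Baire theorem covers only real normed spaces. *)
Lemma complex_Baire (R : realType) (X : completeNormedModType R[i])
    (U : (set X)^nat) :
  (forall n, open (U n) /\ dense (U n)) -> dense (\bigcap_n U n).
Proof.
move=> odU; apply/dense_rnormP => z0 d0 d00.
(* A state is an index with a centre and a radius; the new closed ball lies in the old open ball and
   in [U n]. Nothing is claimed for a nonpositive radius, which makes the step total, so that
   [choice] applies. *)
have step (s : nat * (X * R)) : exists s' : X * R, 0 < s.2.2 ->
    [/\ 0 < s'.2, s'.2 < s.1.+1%:R^-1 &
        forall y, rnorm (s'.1 - y) <= s'.2 -> rnorm (s.2.1 - y) < s.2.2 /\ U s.1 y].
  case: s => n [x r] /=; have [r0|] := pselect (0 < r); last by exists (x, r).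
  have [oU /dense_rnormP dU] := odU n.
  have [y Uy xy] := dU x r r0.
  have [e e0 eU] := (open_rnormP _).1 oU y Uy.
  pose m := Num.min (n.+1%:R^-1) (Num.min e (r - rnorm (x - y))).
  have m0 : 0 < m by rewrite !lt_min invr_gt0 ltr0n e0 subr_gt0.
  exists (y, m / 2) => _ /=.
  have m2 : m / 2 < m by rewrite ltr_pdivrMr// ltr_pMr// ltr1n.
  split; first by rewrite divr_gt0.
    by apply: lt_le_trans m2 _; rewrite ge_min lexx.
  move=> v yv; have {m2}yv : rnorm (y - v) < m by exact: le_lt_trans m2.
  move: yv; rewrite !lt_min => /and3P[_ /eU Uv yv]; split=> //.
  by apply: le_lt_trans (rnorm_triangle _ y _) _; rewrite -ltrBrDl.
have [f fP] := choice step.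
pose fix s n := if n is m.+1 then f (m, s m) else (z0, d0).
have s0 n : 0 < (s n).2 by elim: n => //= n /(fP (n, s n))[].
have sP n := fP (n, s n) (s0 n).
have sS n k y : rnorm ((s (n + k)%N).1 - y) <= (s (n + k)%N).2 ->
    rnorm ((s n).1 - y) <= (s n).2.
  elim: k => [|k IH]; first by rewrite addn0.
  rewrite addnS => /= /(let: And3 _ _ h := sP (n + k)%N in h)[/ltW + _].
  exact: IH.
have ss n m : (n <= m)%N -> rnorm ((s n).1 - (s m).1) <= (s n).2.
  move=> /subnKC <-; apply: (sS n (m - n)%N); rewrite subrr rnorm0; exact/ltW/s0.
(* From index [n.+1] on, all centres lie within [n.+1%:R^-1] of one centre, so they form a Cauchy
   sequence. *)
have /cvg_ex[l sl] : cvg ((fst \o s) @ \oo).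
  suff : cauchy ((fst \o s) @ \oo) by exact: cauchy_cvg.
  suff : cauchy_ex ((fst \o s) @ \oo) by exact: cauchy_exP.
  move=> e /gt0_real_complex[-> e0].
  have [n ne] : exists n, n.+1%:R^-1 < complex.Re e.
    exists (Num.truncn (complex.Re e)^-1).
    by rewrite -ltf_pV2 ?(posrE, invr_gt0)// invrK truncnS_gt.
  exists (s n.+1).1; exists n.+1 => // m /= nm; apply/ball_rnorm.
  apply: le_lt_trans (ss _ _ nm) _; apply: lt_trans ne.
  by have [] := sP n.
(* The closed balls are nested, so the limit lies in each of them; ball [n.+1] is inside [U n], and
   ball 1 inside the initial ball. *)
have sln n : rnorm ((s n).1 - l) <= (s n).2.
  apply/ler_addgt0Pr => e e0.
  have : nbhs l [set y | rnorm (l - y) < e] by apply/nbhs_rnormP; exists e.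
  move=> /sl[N _ Ne].
  apply: le_trans (rnorm_triangle _ (s (maxn n N)).1 _) _.
  rewrite lerD ?ss ?leq_maxl// rnorm_distC ltW//.
  by apply: Ne => /=; rewrite leq_maxr.
exists l => [n _|].
  by have [_ _ /(_ _ (sln n.+1))[]] := sP n.
by have [_ _ /(_ _ (sln 1))[]] := sP 0.
Qed.

(** * Upper and lower limits, Cesaro averages *)

Section RealSequences.
Variable R : realType.
Implicit Type u : nat -> R.

Lemma limn_esupE (u : (\bar R)^nat) :
  limn_esup u = ereal_inf (range (esups u)).
Proof. by rewrite limn_esup_lim; apply/cvg_lim/cvg_esups_inf. Qed.

Lemma limn_einfE (u : (\bar R)^nat) :
  limn_einf u = ereal_sup (range (einfs u)).
Proof. by rewrite limn_einf_lim; apply/cvg_lim/cvg_einfs_sup. Qed.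

Lemma limn_einf_eq0P u : (forall n, 0 <= u n) ->
  limn_einf (fun n => (u n)%:E) = 0%E <->
  forall e : R, 0 < e -> forall N, exists2 n, (N <= n)%N & u n < e.
Proof.
move=> u0; rewrite limn_einfE; split => [sup0 e e0 N|small].
  have : (einfs (fun n => (u n)%:E) N < e%:E)%E.
    apply: (@le_lt_trans _ _ 0%E); last by rewrite lte_fin.
    by rewrite -sup0; apply: ereal_sup_ubound; exists N.
  by move=> /ereal_inf_lt[_ [n /= Nn <-]]; rewrite lte_fin => ?; exists n.
apply/eqP; rewrite eq_le; apply/andP; split.
  apply: ge_ereal_sup => _ [N _ <-]; apply/lee_addgt0Pr => e e0; rewrite add0e.
  have [n Nn ne] := small e e0 N.
  apply: (@le_trans _ _ (u n)%:E); last by rewrite lee_fin ltW.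
  by apply: ereal_inf_lbound; exists n.
apply: (@le_trans _ _ (einfs (fun n => (u n)%:E) 0%N)).
  by apply: le_ereal_inf_tmp => _ [n _ <-]; rewrite lee_fin.
by apply: ereal_sup_ubound; exists 0%N.
Qed.

Lemma limn_esup_gt0P u :
  (0 < limn_esup (fun n => (u n)%:E))%E <->
  exists2 e : R, 0 < e & forall N, exists2 n, (N <= n)%N & e < u n.
Proof.
rewrite limn_esupE; split => [inf0|[e e0 large]].
  have [e e0 einf] : exists2 e : R, 0 < e &
      (e%:E < ereal_inf (range (esups (fun n => (u n)%:E))))%E.
    case: ereal_inf inf0 => [r| |] //; last by exists 1; rewrite ?ltry.
    by rewrite lte_fin => r0; exists (r / 2);
      rewrite ?lte_fin ?divr_gt0// ltr_pdivrMr// ltr_pMr// ltr1n.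
  exists e => // N.
  have : (e%:E < esups (fun n => (u n)%:E) N)%E.
    by apply: lt_le_trans einf _; apply: ereal_inf_lbound; exists N.
  by move=> /ereal_sup_gt[_ [n /= Nn <-]]; rewrite lte_fin => ?; exists n.
apply: (@lt_le_trans _ _ e%:E); first by rewrite lte_fin.
apply: le_ereal_inf_tmp => _ [N _ <-]; have [n Nn /ltW en] := large N.
apply: (@le_trans _ _ (u n)%:E); first by rewrite lee_fin.
by apply: ereal_sup_ubound; exists n.
Qed.

(** Finitely many terms are bounded, so an unbounded sequence is unbounded on every tail and all its
    tail suprema are infinite. *)
Lemma limn_esup_eqyP u :
  limn_esup (fun n => (u n)%:E) = +oo%E <-> forall K : R, exists n, K < u n.
Proof.
rewrite limn_esupE; split => [infy K|large].
  have : (K%:E < esups (fun n => (u n)%:E) 0%N)%E.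
    rewrite (@lt_le_trans _ _ +oo%E) ?ltry// -infy.
    by apply: ereal_inf_lbound; exists 0%N.
  by move=> /ereal_sup_gt[_ [n /= _ <-]]; rewrite lte_fin => ?; exists n.
apply/eqP; rewrite -leye_eq; apply: le_ereal_inf_tmp => _ [N _ <-].
rewrite leye_eq; apply/eqP/eqyP => K _.
(* The sum dominates each of the first [N] terms, which forces [N <= n]. *)
have [n Kn] := large (`|K| + \sum_(i < N) `|u i|).
have sum0 : 0 <= \sum_(i < N) `|u i| by apply: sumr_ge0.
have Nn : (N <= n)%N.
  rewrite leqNgt; apply/negP => nN.
  have : u n <= \sum_(i < N) `|u i|.
    rewrite (bigD1 (Ordinal nN))//= (le_trans (ler_norm _))// lerDl.
    exact: sumr_ge0.
  by rewrite leNgt (le_lt_trans _ Kn)// lerDr.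
apply: (@le_trans _ _ (u n)%:E); last by apply: ereal_sup_ubound; exists n.
by rewrite lee_fin (le_trans (ler_norm _))// (le_trans _ (ltW Kn))// lerDl.
Qed.

(** The unit interval has Lebesgue measure one, whereas countable sets are null. *)
Lemma uncountable_real : ~ countable [set: R].
Proof.
move=> cR; have : countable `[0 : R, 1]%classic by apply: sub_countable cR; exact/subset_card_le/subsetT.
move=> /countable_lebesgue_measure0; rewrite lebesgue_measure_itv/= lte_fin ltr01.
by rewrite sube0 => /eqP; rewrite eqe oner_eq0.
Qed.

(** Real-valued form of [cesaro_mean], convertible to it up to the embedding into the extended
    reals. *)
Definition avg u (N : nat) : R := N%:R^-1 * \sum_(1 <= j < N.+1) u j.

Lemma avg_ge0 u N : (forall j, 0 <= u j) -> 0 <= avg u N.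
Proof. by move=> u0; rewrite mulr_ge0 ?invr_ge0// sumr_ge0. Qed.

(** The sum starts at index 1, so comparing terms of positive index suffices; the norm estimate on
    iterates is given only there. *)
Lemma ler_avg u v N : (forall j, (0 < j)%N -> u j <= v j) -> avg u N <= avg v N.
Proof.
move=> uv; rewrite ler_wpM2l ?invr_ge0//.
by rewrite !big_nat; apply: ler_sum => j /andP[/uv].
Qed.

Lemma avgD u v N : avg (u \+ v) N = avg u N + avg v N.
Proof. by rewrite /avg big_split mulrDr. Qed.

Lemma avgZ u (k : R) N : avg (fun j => k * u j) N = k * avg u N.
Proof. by rewrite /avg -mulr_sumr mulrCA. Qed.

End RealSequences.

(** Meant for exceptional parameters: each unwanted congruence excludes at most one real number. *)
Lemma countable_bigcup_subsingleton (I : countType) (T : Type) (F : I -> set T) :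
  (forall i x y, F i x -> F i y -> x = y) -> countable (\bigcup_i F i).
Proof.
move=> F1; apply: bigcup_countable => // i _.
have [Fi0|/set0P[x Fx]] := eqVneq (F i) set0; first by rewrite Fi0.
by apply: sub_countable (countable1 x); apply: subset_card_le => y /F1/(_ Fx).
Qed.

Lemma countable_preimage_inj (T U : Type) (f : T -> U) (A : set T) :
  injective f -> countable (f @` A) -> countable A.
Proof.
move=> fI /countable_injP[g gI]; apply/countable_injP; exists (g \o f) => x y.
rewrite !inE => Ax Ay /= /gI gxy; apply/fI/gxy; rewrite inE.
  by exists x.
by exists y.
Qed.

(** * Dense uncountable sets modulo a subspace *)

Section GenericTranslates.
Variables (R : realType) (X : normedModType R[i]).

(** Row [m] runs in [V] towards the point [d m] of a dense sequence. Since a whole tail of some row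
    is close to [x], a perturbation decaying along the rows preserves density. *)
Lemma separable_dense_array (V : set X) : separable X -> dense V ->
  exists v : nat * nat -> X, (forall i, V (v i)) /\
    forall x (r : R), 0 < r -> exists m, exists K, forall k, (K <= k)%N ->
      rnorm (x - v (m, k)) < r.
Proof.
move=> [A /countable_injP[h hI] /dense_rnormP dA] /dense_rnormP dV.
pose d m := xget 0 [set a | A a /\ h a = m].
have dh a : A a -> d (h a) = a.
  move=> Aa; rewrite /d; case: xgetP => [_ -> [Ab hab]|/(_ a)[]//].
  by apply: hI; rewrite ?inE.
have /choice[v vP] (i : nat * nat) : exists y, V y /\ rnorm (d i.1 - y) < i.2.+1%:R^-1.
  by have [y] := dV (d i.1) i.2.+1%:R^-1 ltac:(by []); exists y.
exists v; split => [i|x r r0]; first by have [] := vP i.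
have r20 : 0 < r / 2 by rewrite divr_gt0.
have [a Aa xa] := dA x (r / 2) r20.
exists (h a), (Num.truncn (r / 2)^-1) => k Kk.
apply: le_lt_trans (rnorm_triangle _ a _) _; rewrite [ltRHS]splitr ltrD//.
have [_] := vP (h a, k); rewrite /= dh// => /lt_trans; apply.
rewrite -ltf_pV2 ?posrE ?invr_gt0// invrK; apply: lt_le_trans (truncnS_gt _) _.
by rewrite ler_nat.
Qed.

Let code (i : nat * nat) : nat := (2 ^ i.1 * i.2.*2.+1)%N.

(** The 2-adic valuation recovers the row, and the odd cofactor then recovers the column. *)
Let code_inj : injective code.
Proof.
move=> [m k] [m' k'] /= eqc.
have lc i : logn 2 (code i) = i.1.
  by rewrite /code lognM ?expn_gt0// pfactorK// [X in (_ + X)%N]lognE /= dvdn2 /= odd_double addn0.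
have mm : m = m' by have := lc (m, k); rewrite eqc lc.
move: eqc; rewrite /code mm /= => /eqP; rewrite eqn_pmul2l ?expn_gt0// => /eqP[].
by move=> /double_inj ->.
Qed.

(** Makes the perturbation sizes, reciprocals of codes, tend to 0 along each row. *)
Let code_gt m k : (k < code (m, k))%N.
Proof.
apply: leq_trans (leq_pmull _ _); last by rewrite expn_gt0.
by rewrite /= ltnS -addnn leq_addr.
Qed.

(* Countably many generic small multiples of [f0] separate a dense sequence of
   [V] modulo [E], and all but countably many points of the line through [f0] can
   then be added, because two points of that line are never congruent. *)
Lemma dense_uncountable_incongruent (V E : set X) (f0 : X) :
  separable X -> dense V ->
  (forall (t : R) x y, V x -> V y -> V (x + t%:C%C *: y)) ->
  E 0 -> (forall x y, E x -> E y -> E (x + y)) ->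
  (forall (t : R) x, E x -> E (t%:C%C *: x)) ->
  V f0 -> ~ E f0 ->
  exists S : set X, [/\ ~ countable S, dense S, S `<=` V &
    forall x y, S x -> S y -> x <> y -> ~ E (x - y)].
Proof.
move=> sX dV VD E0 ED EZ Vf0 Ef0.
have EN x : E x -> E (- x).
  by move=> /(EZ (- 1)); rewrite rmorphN rmorph1 scaleN1r.
have EB x y : E x -> E y -> E (x - y) by move=> Ex /EN; exact: ED.
have Eline (t : R) : E (t%:C%C *: f0) -> t = 0.
  move=> Et; apply: contrapT => /eqP t0; apply: Ef0.
  by have := EZ t^-1 _ Et; rewrite scalerA -rmorphM mulVf// rmorph1 scale1r.
have [v [Vv vP]] := separable_dense_array sX dV.
pose q i : R := (code i)%:R^-1.
have qI : injective q by move=> i j /invr_inj/eqP; rewrite eqr_nat => /eqP/code_inj.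
pose p (s : R) i := v i + (s * q i)%:C%C *: f0.
(* For a fixed pair [i <> j] at most one [s] is bad: subtracting two bad cases leaves
   [(s - t) * (q i - q j)] times [f0] in [E]. So the bad [s] are countably many. *)
have [s sP] : exists s, forall i j, i <> j -> ~ E (p s i - p s j).
  apply: contrapT => bad; apply: (@uncountable_real R).
  pose F (ij : (nat * nat) * (nat * nat)) :=
    [set s | ij.1 <> ij.2 /\ E (p s ij.1 - p s ij.2)].
  apply: (@sub_countable _ _ _ (\bigcup_ij F ij)); last first.
    apply: countable_bigcup_subsingleton => -[i j] s t /= [ij Es] [_ Et].
    have : E (((s - t) * (q i - q j))%:C%C *: f0).
      have := EB _ _ Es Et; congr E.
      have cancel_base (x y a b a' b' : X) :
          (x + a - (y + b)) - (x + a' - (y + b')) = a - b - (a' - b').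
        rewrite (opprD y b) (opprD y b') (addrACA x a) (addrACA x a').
        by set u := x - y; rewrite (opprD u) (addrACA u) subrr add0r.
      rewrite cancel_base -!scalerBl; congr (_ *: _).
      by rewrite -!rmorphB mulrBl !mulrBr.
    move=> /Eline/eqP; rewrite mulf_eq0 !subr_eq0 => /orP[/eqP//|/eqP/qI//].
  apply: subset_card_le => s _; apply: contrapT => sF; apply: bad; exists s.
  by move=> i j ij Eij; apply: sF; exists (i, j).
(* Likewise, each [p s i] is congruent to at most one point of the line through [f0]. *)
pose F i := [set t : R | E (t%:C%C *: f0 - p s i)].
have cF : countable (\bigcup_i F i).
  apply: countable_bigcup_subsingleton => i t t' Et Et'.
  apply/eqP; rewrite -subr_eq0; apply/eqP/Eline.
  by have := EB _ _ Et Et'; rewrite opprB addrA subrK -scalerBl rmorphB.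
exists (range (p s) `|` [set t%:C%C *: f0 | t in ~` \bigcup_i F i]); split.
- move=> /(sub_countable (subset_card_le (@subsetUr _ _ _))) cS.
  apply: (@uncountable_real R).
  rewrite -(setUv (\bigcup_i F i)) -bigcup2E; apply: bigcup_countable => // -[//|[|[|n]]] _ /=.
  - apply: (countable_preimage_inj (f := fun t : R => t%:C%C *: f0)) cS => t t' tt'.
    by apply/eqP; rewrite -subr_eq0; apply/eqP/Eline; rewrite rmorphB scalerBl tt' subrr.
  - exact: countable0.
  - exact: countable0.
- apply/dense_rnormP => x r r0.
  have r20 : 0 < r / 2 by rewrite divr_gt0.
  have [m [K mK]] := vP x (r / 2) r20.
  pose c := `|s| * rnorm f0.
  (* The first bound puts [v (m, k)] within [r / 2] of [x]; the second makes the perturbation, of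
     norm [c] over the code, smaller than [r / 2]. *)
  pose k := maxn K (Num.truncn (c / (r / 2))).
  exists (p s (m, k)); first by left; exists (m, k).
  rewrite /p opprD addrA (le_lt_trans (rnormD _ _))// rnormN rnormZ.
  rewrite [ltRHS]splitr ltrD ?mK ?leq_maxl//.
  rewrite normrM mulrAC normfV normr_nat -/c ltr_pdivrMr; last first.
    by rewrite ltr0n; apply: leq_ltn_trans (code_gt m k).
  rewrite mulrC -ltr_pdivrMr// (lt_le_trans (truncnS_gt _))// ler_nat.
  by apply: leq_trans (code_gt m k); rewrite ltnS leq_maxr.
- move=> _ [[i _ <-]|[t _ <-]]; first exact: VD.
  (* Writes [t f0] as [f0 + (t - 1) f0], the form covered by the closure property of [V]. *)
  by have := VD (t - 1) _ _ Vf0 Vf0; rewrite rmorphB scalerBl rmorph1 scale1r addrC subrK.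
- move=> _ _ [[i _ <-]|[t Ft <-]] [[j _ <-]|[t' Ft' <-]].
  + by move=> pp; apply: sP => ij; apply: pp; rewrite ij.
  + by move=> _ /EN; rewrite opprB => Ei; apply: Ft'; exists i.
  + by move=> _ Ej; apply: Ft; exists j.
  + move=> tt' Ett'; apply: tt'; congr (_%:C%C *: _).
    by apply/eqP; rewrite -subr_eq0; apply/eqP/Eline; rewrite rmorphB scalerBl.
Qed.

End GenericTranslates.

(** * Residual sets in a complete space *)

Section Category.
Variables (R : realType) (X : completeNormedModType R[i]).

Lemma residual_bigcap (U : (set X)^nat) :
  (forall n, open (U n) /\ dense (U n)) -> residual (\bigcap_n U n).
Proof.
move=> odU; exists (fun n => ~` U n); split => [n|]; last by rewrite setC_bigcap.
have [/interior_id oU dU] := odU n.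
rewrite /nowhere_dense closure_setC oU -subset0 => x /nbhs_rnormP[r r0 rU].
have [y Uy] := (dense_rnormP _).1 dU x r r0.
by move=> /rU.
Qed.

(** The complements of the closures of the nowhere dense sets are open and dense, so by Baire they
    share a point. *)
Lemma residual_neq0 (A : set X) : residual A -> A !=set0.
Proof.
move=> [F [ndF AF]].
have /complex_Baire/dense_rnormP/(_ 0 1 ltr01)[x Fx _] :
    forall n, open (~` closure (F n)) /\ dense (~` closure (F n)).
  move=> n; split; first by rewrite openC; exact: closed_closure.
  apply/dense_rnormP => x r r0; apply: contrapT => noy.
  suff : interior (closure (F n)) x by rewrite ndF.
  apply/nbhs_rnormP; exists r => // y xy; apply: contrapT => Fy; apply: noy.
  by exists y.
exists x; apply: contrapT => /AF[n _ Fnx].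
by apply: (Fx n) => //; exact: subset_closure.
Qed.

End Category.

(** * Orbit means of a bounded operator *)

Section OrbitMeans.
Variables (R : realType) (X : normedModType R[i]) (T : X -> X).
Hypothesis T_bounded : bounded_operator T.

Definition orbit_avg (x : X) (N : nat) : R := avg (fun j => rnorm (iter j T x)) N.

Lemma orbit_avg_ge0 x N : 0 <= orbit_avg x N.
Proof. by apply: avg_ge0 => j; exact: rnorm_ge0. Qed.

Lemma iter_operatorD j x y : iter j T (x + y) = iter j T x + iter j T y.
Proof.
elim: j => //= j ->; have [Tl _] := T_bounded.
by rewrite -[in LHS](scale1r (iter j T x)) Tl scale1r.
Qed.

Lemma iter_operatorZ j a x : iter j T (a *: x) = a *: iter j T x.
Proof.
have [Tl _] := T_bounded.
have T0 : T 0 = 0 by have := Tl (-1) 0 0; rewrite scaler0 addr0 scaleN1r addNr.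
by elim: j => //= j ->; rewrite -[_ *: iter j T x]addr0 Tl T0 addr0.
Qed.

Lemma orbit_avgD x y N : orbit_avg (x + y) N <= orbit_avg x N + orbit_avg y N.
Proof.
rewrite /orbit_avg -avgD; apply: ler_avg => j _ /=.
by rewrite iter_operatorD; exact: rnormD.
Qed.

Lemma orbit_avgZ (t : R) x N : orbit_avg (t%:C%C *: x) N = `|t| * orbit_avg x N.
Proof.
rewrite /orbit_avg -avgZ; congr (_ * _); apply: eq_bigr => j _.
by rewrite iter_operatorZ rnormZ.
Qed.

Lemma orbit_avgN x N : orbit_avg (- x) N = orbit_avg x N.
Proof.
have -> : - x = (-1 : R)%:C%C *: x by rewrite rmorphN rmorph1 scaleN1r.
by rewrite orbit_avgZ normrN1 mul1r.
Qed.

Lemma mean_orbit_distE x y : mean_orbit_dist T x y = mean_orbit T (x - y).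
Proof.
apply/funext => N; congr (_ * _)%:E; apply: eq_bigr => j _.
by rewrite iter_operatorD -[in RHS](scaleN1r y) iter_operatorZ scaleN1r.
Qed.

Lemma orbit_avg_le_rnorm N :
  exists2 L : R, 0 < L & forall x, orbit_avg x N <= L * rnorm x.
Proof.
have [_ [B TB]] := T_bounded.
have TK x : rnorm (T x) <= `|B| * rnorm x.
  by apply: le_trans (TB x) _; rewrite ler_wpM2r ?rnorm_ge0// ler_norm.
have TjK j x : rnorm (iter j T x) <= `|B| ^+ j * rnorm x.
  elim: j => [|j IH] /=; first by rewrite mul1r.
  by apply: le_trans (TK _) _; rewrite exprS -mulrA ler_wpM2l.
(* The added 1 keeps the constant positive even when the average vanishes, as for [N = 0]. *)
exists (avg (fun j => `|B| ^+ j) N + 1) => [|x].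
  by rewrite ltr_wpDl// avg_ge0// => j; rewrite exprn_ge0.
apply: le_trans (_ : avg (fun j => rnorm x * `|B| ^+ j) N <= _).
  by apply: ler_avg => j _; rewrite mulrC.
by rewrite avgZ mulrC ler_wpM2r ?rnorm_ge0// lerDl.
Qed.

(** Each fixed mean is a seminorm bounded by [L] times the norm, hence [L]-Lipschitz. *)
Lemma orbit_avg_near N x (e : R) : 0 < e ->
  exists2 r : R, 0 < r & forall y, rnorm (x - y) < r ->
    `|orbit_avg x N - orbit_avg y N| < e.
Proof.
move=> e0; have [L L0 LP] := orbit_avg_le_rnorm N.
exists (e / L) => [|y]; first exact: divr_gt0.
rewrite ltr_pdivlMr// mulrC => /(le_lt_trans (LP _)); apply: le_lt_trans.
rewrite ler_norml; apply/andP; split; last first.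
  by rewrite lerBlDr; have := orbit_avgD (x - y) y N; rewrite subrK.
rewrite lerNl opprB lerBlDr -(orbit_avgN (x - y)) opprB.
by have := orbit_avgD (y - x) x N; rewrite subrK.
Qed.

(** These vectors form the real subspace modulo which the chaotic set is separated. *)
Definition orbit_avg_null (x : X) : Prop :=
  forall e : R, 0 < e -> exists N, forall n, (N <= n)%N -> orbit_avg x n <= e.

Lemma orbit_avg_nullP x :
  orbit_avg_null x <-> ~ (0 < limn_esup (mean_orbit T x))%E.
Proof.
rewrite limn_esup_gt0P; split => [xnull [e /xnull[N Ne] /(_ N)[n /Ne]]|nlarge e e0].
  by rewrite leNgt => /negP.
apply: contrapT => noN; apply: nlarge; exists e => // N.
apply: contrapT => non; apply: noN; exists N => n Nn.
by rewrite leNgt; apply/negP => en; apply: non; exists n.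
Qed.

Lemma orbit_avg_null0 : orbit_avg_null 0.
Proof.
move=> e e0; exists 0%N => n _.
by rewrite -(scale0r (0 : X)) -(rmorph0 (real_complex R)) orbit_avgZ normr0 mul0r ltW.
Qed.

Lemma orbit_avg_nullD x y :
  orbit_avg_null x -> orbit_avg_null y -> orbit_avg_null (x + y).
Proof.
move=> xn yn e e0; have e20 : 0 < e / 2 by rewrite divr_gt0.
have [N Ne] := xn _ e20; have [N' N'e] := yn _ e20.
exists (maxn N N') => n; rewrite geq_max => /andP[/Ne xe /N'e ye].
by rewrite (le_trans (orbit_avgD _ _ _))// [leRHS]splitr lerD.
Qed.

Lemma orbit_avg_nullZ (t : R) x : orbit_avg_null x -> orbit_avg_null (t%:C%C *: x).
Proof.
move=> xn e e0; have t0 : 0 < `|t| + 1 by rewrite ltr_wpDl.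
have [N Ne] := xn (e / (`|t| + 1)) ltac:(by rewrite divr_gt0).
exists N => n /Ne; rewrite ler_pdivlMr// orbit_avgZ => /(le_trans _); apply.
by rewrite mulrC ler_wpM2l ?orbit_avg_ge0// lerDl.
Qed.

(* An orbit that is small at one time stays small in mean from then on. *)
Lemma Cesaro_bounded_null x : absolutely_Cesaro_bounded T ->
  (forall e : R, 0 < e -> forall N, exists2 n, (N <= n)%N & orbit_avg x n < e) ->
  orbit_avg_null x.
Proof.
move=> [C C0 CP] xsmall e e0; pose d := e / 2 / C.
have d0 : 0 < d by rewrite !divr_gt0.
have [n n0 nd] := xsmall d d0 1%N.
(* Were all iterates of norm at least [d], so would be the mean at the positive time [n]. *)
have [j jd] : exists j, rnorm (iter j T x) < d.
  apply: contrapT => large; move: nd; apply/negP; rewrite -leNgt.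
  have davg : avg (fun=> d) n = d.
    rewrite /avg sumr_const_nat subn1 /= -(mulr_natl d) mulKf//.
    by rewrite pnatr_eq0 -lt0n.
  rewrite -[leLHS]davg; apply: ler_avg => j _.
  by rewrite leNgt; apply/negP => ?; apply: large; exists j.
pose S := \sum_(1 <= i < j.+1) rnorm (iter i T x).
have S0 : 0 <= S by apply: sumr_ge0 => i _; exact: rnorm_ge0.
(* The first bound allows splitting the sum after time [j]; the second makes [S / m] at most
   [e / 2]. *)
exists (maxn j.+1 (Num.truncn (S / (e / 2))).+1) => m; rewrite geq_max => /andP[jm Sm].
have m0 : (0 < m)%N by exact: leq_trans jm.
have Rm0 : 0 < m%:R :> R by rewrite ltr0n.
apply: (@le_trans _ _ (m%:R^-1 * S + orbit_avg (iter j T x) m)).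
  rewrite /orbit_avg /avg -mulrDr ler_wpM2l ?invr_ge0//.
  rewrite (@big_cat_nat _ _ _ j.+1)//=; last by rewrite ltnW// ltnS.
  (* Shifted by [j], the remaining sum consists of the first [m - j] terms of the orbit of
     [iter j T x]; completing it to [m] terms can only increase it. *)
  rewrite lerD2l -{1}(add1n j) big_addn.
  rewrite [leRHS](@big_cat_nat _ _ _ (m.+1 - j))//=; last 2 first.
  - by rewrite subn_gt0 ltnS ltnW.
  - exact: leq_subr.
  rewrite -[leLHS]addr0 lerD//; last by apply: sumr_ge0 => i _; exact: rnorm_ge0.
  by apply: ler_sum => i _; rewrite -iterD.
rewrite [leRHS]splitr lerD//.
  rewrite mulrC ler_pdivrMr// mulrC -ler_pdivrMr ?divr_gt0//.
  by rewrite (le_trans (ltW (truncnS_gt _)))// ler_nat.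
have := CP (iter j T x) m m0; rewrite lee_fin => /le_trans; apply.
by rewrite mulrC -ler_pdivlMr// ltW.
Qed.

Lemma open_orbit_avg_gt (k : R) : open [set x | exists N, k < orbit_avg x N].
Proof.
apply/open_rnormP => x [N kN].
have [r r0 rP] := @orbit_avg_near N x (orbit_avg x N - k) ltac:(by rewrite subr_gt0).
exists r => // y /rP; rewrite ltr_norml => /andP[_ h]; exists N.
by move: h; rewrite ltrD2l ltrN2.
Qed.

(** A uniform boundedness argument: if the set misses a ball, all means are at most [k] on that
    ball, then on the ball of the same radius at 0, and homogeneity gives a Cesaro bound. *)
Lemma dense_orbit_avg_gt (k : R) : ~ absolutely_Cesaro_bounded T ->
  dense [set x | exists N, k < orbit_avg x N].
Proof.
move=> nCb; apply/dense_rnormP => x0 r r0; apply: contrapT => noy; apply: nCb.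
have ball_le y N : rnorm (x0 - y) < r -> orbit_avg y N <= k.
  move=> xy; rewrite leNgt; apply/negP => ky; apply: noy; exists y => //.
  by exists N.
(* Since [2 z = (x0 + z) + (z - x0)] and a vector has the same means as its opposite, both summands
   are controlled by the ball at [x0]. *)
have le_k z N : rnorm z < r -> orbit_avg z N <= k.
  move=> zr.
  have p : orbit_avg (x0 + z) N <= k.
    by apply: ball_le; rewrite opprD addNKr rnormN.
  have m : orbit_avg (z - x0) N <= k.
    by rewrite -orbit_avgN opprB; apply: ball_le; rewrite opprB addrC subrK.
  have : orbit_avg ((2 : R)%:C%C *: z) N <= k + k.
    have -> : (2 : R)%:C%C *: z = (x0 + z) + (z - x0).
      by rewrite rmorph_nat scaler_nat mulr2n [RHS]addrC addrA subrK.
    by apply: le_trans (orbit_avgD _ _ _) _; exact: lerD.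
  by rewrite orbit_avgZ ger0_norm// -mulr2n -(mulr_natl k) ler_pM2l.
have k0 : 0 <= k by apply: le_trans (orbit_avg_ge0 0 0) (le_k _ _ _); rewrite rnorm0.
(* Vectors of norm [r / 2] have means at most [k]; the added 1 covers [k = 0]. *)
exists (k / (r / 2) + 1) => [|x N N0].
  by rewrite ltr_wpDl// divr_ge0// divr_ge0// ltW.
rewrite lee_fin -/(orbit_avg x N).
have [x_eq0|x_neq0] := eqVneq (rnorm x) 0.
  have [L _ /(_ x)] := orbit_avg_le_rnorm N.
  by rewrite x_eq0 !mulr0.
have x_gt0 : 0 < rnorm x by rewrite lt_neqAle eq_sym x_neq0 rnorm_ge0.
pose t := r / 2 / rnorm x.
have t0 : 0 < t by rewrite !divr_gt0.
have : orbit_avg (t%:C%C *: x) N <= k.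
  apply: le_k; rewrite rnormZ gtr0_norm// divfK//.
  by rewrite ltr_pdivrMr// ltr_pMr// ltr1n.
rewrite orbit_avgZ gtr0_norm// mulrC -ler_pdivlMr// => /le_trans; apply.
rewrite /t invf_div mulrA mulrDl mul1r mulrAC lerDl; exact: rnorm_ge0.
Qed.

End OrbitMeans.

(** * Chaos for an operator whose orbit means are dominated on a dense set *)

Section DominatedOrbits.
Variables (R : realType) (X : completeNormedModType R[i]) (T : X -> X).
Variables (c : nat -> R) (D : set X).
Hypotheses (T_bounded : bounded_operator T) (X_sep : separable X).
Hypotheses (c_ge0 : forall n, 0 <= c n)
  (c_small : forall e : R, 0 < e -> forall N, exists2 n, (N <= n)%N & c n < e).
Hypotheses (D_dense : dense D)
  (D_dominated : forall x, D x -> exists K : R, forall N, orbit_avg T x N <= K * c N).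

Let D_dominated_pos x : D x ->
  exists2 K : R, 0 < K & forall N, orbit_avg T x N <= K * c N.
Proof.
move=> /D_dominated[K KP]; exists (`|K| + 1) => [|N]; first by rewrite ltr_wpDl.
by apply: le_trans (KP N) _; rewrite ler_wpM2r// (le_trans (ler_norm K))// lerDl.
Qed.

(** Under a uniform bound, means of vectors of [D] tend to 0, since their lower limit is 0;
    approximating [y0] from [D] carries this over to [y0]. *)
Lemma not_Cesaro_bounded (y0 : X) : (0 < limn_esup (mean_orbit T y0))%E ->
  ~ absolutely_Cesaro_bounded T.
Proof.
move=> /[swap] Cb; apply/(orbit_avg_nullP T y0) => e e0.
have [C C0 CP] := Cb; have e20 : 0 < e / 2 by rewrite divr_gt0.
have [|f Df yf] := (dense_rnormP _).1 D_dense y0 (e / 2 / C).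
  exact: divr_gt0.
have [K K0 KP] := D_dominated_pos Df.
have [d d0 N|N Ne] := Cesaro_bounded_null (x := f) Cb _ e20.
  have [n Nn nd] := c_small (divr_gt0 d0 K0) N; exists n => //.
  by apply: le_lt_trans (KP n) _; rewrite mulrC -ltr_pdivlMr.
(* The successor makes [n] positive, as the Cesaro bound concerns positive times only. *)
exists N.+1 => n Nn; rewrite -(subrK f y0).
apply: le_trans (orbit_avgD T_bounded _ _ _) _; rewrite [leRHS]splitr lerD//.
  have := CP (y0 - f) n (leq_ltn_trans (leq0n N) Nn); rewrite lee_fin => /le_trans; apply.
  by rewrite mulrC -ler_pdivlMr// ltW.
exact/Ne/ltnW.
Qed.

Lemma open_orbit_avg_small (n : nat) :
  open [set x | exists2 N, (n <= N)%N & orbit_avg T x N + c N < n.+1%:R^-1].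
Proof.
apply/open_rnormP => x [N nN]; rewrite -subr_gt0 => /(orbit_avg_near T_bounded N x)[r r0 rP].
exists r => // y /rP; rewrite ltr_norml => /andP[h _]; exists N => //.
by move: h; rewrite ltrNl opprB ltrBlDr opprD addrAC addrA addrK ltrBrDr.
Qed.

(** On [D] the quantity is at most [(K + 1) * c N], hence small whenever [c N] is. *)
Lemma dense_orbit_avg_small (n : nat) :
  dense [set x | exists2 N, (n <= N)%N & orbit_avg T x N + c N < n.+1%:R^-1].
Proof.
apply/dense_rnormP => x r r0.
have [f Df xf] := (dense_rnormP _).1 D_dense x r r0; exists f => //.
have [K K0 KP] := D_dominated_pos Df.
have K10 : 0 < K + 1 by rewrite addr_gt0.
have [|N nN Ne] := c_small (e := n.+1%:R^-1 / (K + 1)) _ n; first by rewrite divr_gt0.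
exists N => //; apply: (@le_lt_trans _ _ (c N * (K + 1))); last by rewrite -ltr_pdivlMr.
by rewrite mulrDr mulr1 lerD2r mulrC.
Qed.

(** Adding [c N] to the orbit mean forces both to be small at the same time [N], so that vectors
    dominated by either can be combined. *)
Let joint_irregular : set X := \bigcap_n
  ([set x | exists N, n%:R < orbit_avg T x N] `&`
   [set x | exists2 N, (n <= N)%N & orbit_avg T x N + c N < n.+1%:R^-1]).

Let joint_irregular_residual :
  ~ absolutely_Cesaro_bounded T -> residual joint_irregular.
Proof.
move=> nCb; apply: residual_bigcap => n; split.
  by apply: openI; [exact: open_orbit_avg_gt|exact: open_orbit_avg_small].
(* The second dense set meets the nonempty open part of [O] cut out by the first. *)
move=> O O0 Oo; rewrite setIA; apply: dense_orbit_avg_small.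
  exact: dense_orbit_avg_gt.
by apply: openI => //; exact: open_orbit_avg_gt.
Qed.

Let joint_irregular_small y : joint_irregular y ->
  forall e : R, 0 < e -> forall N, exists2 n, (N <= n)%N & orbit_avg T y n + c n < e.
Proof.
move=> Gy e e0 N; pose m := maxn N (Num.truncn e^-1).
have [_ [n mn nm]] := Gy m I; exists n; first by apply: leq_trans mn; exact: leq_maxl.
apply: lt_le_trans nm _; rewrite -[leRHS]invrK lef_pV2 ?posrE ?invr_gt0//.
by rewrite (le_trans (ltW (truncnS_gt _)))// ler_nat ltnS leq_maxr.
Qed.

Let joint_irregular_unbounded y : joint_irregular y ->
  forall K : R, exists n, K < orbit_avg T y n.
Proof.
move=> Gy K; have [[n Kn] _] := Gy (Num.truncn K).+1 I.
by exists n; apply: lt_trans Kn; exact: truncnS_gt.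
Qed.

Let joint_irregular_sub : joint_irregular `<=` absolutely_mean_irregular T.
Proof.
move=> y Gy; split; last exact/limn_esup_eqyP/joint_irregular_unbounded.
apply/limn_einf_eq0P => [n|e e0 N]; first exact: orbit_avg_ge0.
have [n Nn ne] := joint_irregular_small Gy e0 N; exists n => //.
by apply: le_lt_trans ne; rewrite lerDl.
Qed.

(* All vectors dominated by the orbit means of one suitable irregular [y] and by
   [c] have small means along a common subsequence; they form a dense subspace. *)
Lemma densely_chaotic : ~ absolutely_Cesaro_bounded T ->
  densely_mean_Li_Yorke_chaotic T.
Proof.
move=> /joint_irregular_residual/residual_neq0[y Gy].
pose V : set X := [set x | exists2 K : R, 0 < K &
  forall N, orbit_avg T x N <= K * (orbit_avg T y N + c N)].
have g0 N : 0 <= orbit_avg T y N + c N by rewrite addr_ge0// orbit_avg_ge0.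
have Vsmall x : V x -> limn_einf (mean_orbit T x) = 0%E.
  move=> [K K0 KP]; apply/limn_einf_eq0P => [n|e e0 N]; first exact: orbit_avg_ge0.
  have [n Nn ne] := joint_irregular_small Gy (divr_gt0 e0 K0) N; exists n => //.
  by apply: le_lt_trans (KP n) _; rewrite mulrC -ltr_pdivlMr.
have VD (t : R) x z : V x -> V z -> V (x + t%:C%C *: z).
  move=> [K K0 KP] [L L0 LP]; exists (K + `|t| * L) => [|N].
    by rewrite ltr_wpDr// mulr_ge0// ltW.
  apply: le_trans (orbit_avgD T_bounded _ _ _) _.
  by rewrite orbit_avgZ// mulrDl -mulrA lerD// ler_wpM2l.
have DV : D `<=` V.
  move=> x /D_dominated_pos[K K0 KP]; exists K => // N.
  by apply: le_trans (KP N) _; rewrite ler_wpM2l ?(ltW K0)// lerDr orbit_avg_ge0.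
have Vdense : dense V.
  by move=> O O0 Oo; have [x [Ox /DV Vx]] := D_dense O0 Oo; exists x.
(* [y] lies in [V] although its means do not tend to 0, so it can serve as direction of the
   perturbations. *)
have Vy : V y by exists 1 => // N; rewrite mul1r lerDl.
have ynull : ~ orbit_avg_null T y.
  move=> /orbit_avg_nullP; apply.
  by have [_ ->] := joint_irregular_sub Gy.
have [S [Suncount Sdense SV Sinc]] := dense_uncountable_incongruent X_sep Vdense VD
  (orbit_avg_null0 T_bounded) (@orbit_avg_nullD _ _ _ T_bounded)
  (@orbit_avg_nullZ _ _ _ T_bounded) Vy ynull.
(* Differences of points of [S] stay in [V], giving lower limit 0; being incongruent modulo null
   vectors gives a positive upper limit. *)
exists S; split=> // x z Sx Sz xz; rewrite mean_orbit_distE//; split.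
  apply: Vsmall; rewrite -scaleN1r -(rmorph1 (real_complex R)) -rmorphN.
  by apply: VD; exact: SV.
apply: contrapT => /orbit_avg_nullP; exact: Sinc.
Qed.

(** Any chaotic pair (through its difference), irregular vector or [y0] has means with positive
    upper limit, which excludes Cesaro boundedness; this in turn yields residuality of
    [joint_irregular] and dense chaos. *)
Lemma mean_chaos_equiv :
  [<-> densely_mean_Li_Yorke_chaotic T;
       exists A : set X, residual A /\
         A `<=` [set x | absolutely_mean_irregular T x];
       ~ absolutely_Cesaro_bounded T;
       exists y0 : X, (0 < limn_esup (mean_orbit T y0))%E].
Proof.
tfae.
- move=> [S [Suncount _ LY]]; exists joint_irregular; split; last exact: joint_irregular_sub.
  have [x [y [Sx Sy xy]]] : exists x y, [/\ S x, S y & x <> y].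
    apply: contrapT => same; apply: Suncount.
    have [->|/set0P[x Sx]] := eqVneq S set0; first exact: countable0.
    apply: sub_countable (countable1 x); apply: subset_card_le => y Sy.
    by apply: contrapT => yx; apply: same; exists y, x.
  have [_] := LY x y Sx Sy xy; rewrite mean_orbit_distE// => /not_Cesaro_bounded.
  exact: joint_irregular_residual.
- move=> [A [/residual_neq0[x Ax] /(_ x Ax)[_ infty]]].
  by apply: (@not_Cesaro_bounded x); rewrite infty.
- move=> /joint_irregular_residual/residual_neq0[y /joint_irregular_sub[_ infty]].
  by exists y; rewrite infty.
- by move=> [y /not_Cesaro_bounded]; exact: densely_chaotic.
Qed.

End DominatedOrbits.

(** * Application to weighted composition operators *)

Lemma elt_ev (R : realType) (X : normedModType R[i]) (ev : X -> R[i] -> R[i]) :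
  analytic_function_space ev -> forall x, elt ev (ev x) = x.
Proof.
move=> X_analytic x; rewrite /elt; case: xgetP => [_ -> xy|/(_ x)]; last by case.
exact: ev_inj X_analytic _ _ xy.
Qed.

Unset Implicit Arguments.
Set Strict Implicit.
Set Printing Implicit Defensive.

Theorem theorem5 (R : realType) (X : completeNormedModType R[i])
  (ev : X -> R[i] -> R[i])
  (X_analytic : analytic_function_space ev)
  (X_infdim : infinite_dimensional X)
  (X_separable : separable X)
  (Hinf_sub : forall h : R[i] -> R[i], Hinf h -> in_space ev h)
  (Hinf_dense : dense [set x : X | Hinf (ev x)])
  (wcomp_bdd : forall psi u : R[i] -> R[i], self_map psi -> Hinf u ->
    wcomp_bounded ev u psi)
  (wcomp_iter_le : forall psi u : R[i] -> R[i], self_map psi -> Hinf u ->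
    forall (f : R[i] -> R[i]) (n : nat), Hinf f -> (0 < n)%N ->
    rnorm (iter n (wcomp_op ev u psi) (elt ev f))
      <= rnorm (elt ev (wprod u psi n)) * supnorm f)
  (phi w : R[i] -> R[i])
  (phi_self : self_map phi)
  (w_Hinf : Hinf w)
  (w_liminf :
    limn_einf (cesaro_mean (fun j : nat => rnorm (elt ev (wprod w phi j)))) = 0%E) :
  [<-> densely_mean_Li_Yorke_chaotic (wcomp_op ev w phi);
       exists A : set X, residual A /\
         A `<=` [set x | absolutely_mean_irregular (wcomp_op ev w phi) x];
       ~ absolutely_Cesaro_bounded (wcomp_op ev w phi);
       exists y0 : X, (0 < limn_esup (mean_orbit (wcomp_op ev w phi) y0))%E].
Proof.
have [_ T_bounded] := wcomp_bdd phi w phi_self w_Hinf.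
pose c := avg (fun j => rnorm (elt ev (wprod w phi j))).
have c_ge0 n : 0 <= c n by apply: avg_ge0 => j; exact: rnorm_ge0.
(* The dense set consists of the bounded functions, and [c] is the sequence of averaged norms of the
   products [w^(j)]. *)
apply: (mean_chaos_equiv (c := c) T_bounded X_separable c_ge0 _ Hinf_dense).
  exact/(limn_einf_eq0P c_ge0).
move=> x Hx; exists (supnorm (ev x)) => N; rewrite -avgZ; apply: ler_avg => j j0.
rewrite mulrC -[in leLHS](elt_ev X_analytic x).
exact: wcomp_iter_le.
Qed.
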